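(* Let $\mathcal X_i=\{z\in\mathbb R^{n_i}:F_iz\le f_i\}$ be a nonempty polyhedron whose rows $F_{i,k}$ are all nonzero. Let $\hat z:=x_i^{\mathrm{nom},\star}(l+1|t)\in\mathbb R^{n_i}$ and $\delta:=\delta_i(l|t+1)\ge0$. Then $\hat z\in\mathcal X_i\ominus\mathbb B_{\delta}$ if and only if, for every row $k$, $$F_{i,k}\hat z+\|F_{i,k}\|_2\,\delta\le f_{i,k}.$$ For a box $\mathcal X_i=\{z:\underline x_i\le z\le\overline x_i\}$ this is equivalent to $$\underline x_i+\delta\mathbf 1\le\hat z\le\overline x_i-\delta\mathbf 1.$$ If, moreover, $\hat z$ belongs to $\mathcal E(c,Q):=\{c+Q^{1/2}w:\|w\|_2\le1\}$, $Q\succeq0$, and $\delta\le\bar\delta$, then the condition $$F_{i,k}c+\sqrt{F_{i,k}QF_{i,k}^\top}+\|F_{i,k}\|_2\bar\delta\le f_{i,k}\quad\text{for every row }k$$ is sufficient for $\hat z\in\mathcal X_i\ominus\mathbb B_\delta$ (a uniform certificate for all such $\hat z$ and $\delta$).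
   Context: $\mathbb B_\Delta=\{e\in\mathbb R^{n_i}:\|e\|_2\le\Delta\}$; $\mathcal S\ominus\mathcal E=\{z:z+e\in\mathcal S\ \forall e\in\mathcal E\}$; $\mathbf 1$ is the all-ones vector; vector inequalities are componentwise; $Q^{1/2}$ is the symmetric positive semidefinite square root. In the source, $x_i^{\mathrm{nom},\star}(l+1|t)$ is a predicted (optimized nominal) state of subsystem $i$ and $\delta_i(l|t+1)\ge0$ is a nonnegative shift margin; for this statement they are just a point $\hat z$ of $\mathbb R^{n_i}$ and a nonnegative number $\delta$. *)

(* Defs.v *)
From mathcomp Require Import all_boot all_order all_algebra.
From mathcomp Require Import boolp classical_sets reals.

Set Implicit Arguments.
Unset Strict Implicit.
Unset Printing Implicit Defensive.

Import Order.TTheory GRing.Theory Num.Theory.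

Local Open Scope classical_set_scope.
Local Open Scope ring_scope.

(* The library's norm on matrices is the sup norm, hence a separate Euclidean
   norm. *)
Definition l2norm (R : realType) (n : nat) (v : 'cV[R]_n) : R :=
  Num.sqrt (\sum_(i < n) v i 0 ^+ 2).

Definition lecv (R : realType) (n : nat) (u v : 'cV[R]_n) : Prop :=
  forall i, u i 0 <= v i 0.

Definition l2ball (R : realType) (n : nat) (r : R) : set 'cV[R]_n :=
  [set e | l2norm e <= r].
Arguments l2ball {R} n r.

Definition pontryagin_diff (R : realType) (n : nat) (S E : set 'cV[R]_n) :
    set 'cV[R]_n :=
  [set z | forall e, E e -> S (z + e)].

Definition polyhedron (R : realType) (m n : nat)
    (F : 'M[R]_(m, n)) (f : 'cV[R]_m) : set 'cV[R]_n :=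
  [set z | lecv (F *m z) f].

Definition box (R : realType) (n : nat) (lo hi : 'cV[R]_n) : set 'cV[R]_n :=
  [set z | lecv lo z /\ lecv z hi].

Definition psdmx (R : realType) (n : nat) (Q : 'M[R]_n) : Prop :=
  Q^T = Q /\ forall v : 'cV[R]_n, 0 <= (v^T *m Q *m v) 0 0.

(* For positive semidefinite Q the set below is a singleton; 0 is only the
   default value for the other Q. *)
Definition psd_sqrtmx (R : realType) (n : nat) (Q : 'M[R]_n) : 'M[R]_n :=
  xget 0 [set S | psdmx S /\ S *m S = Q].

Definition ellipsoid (R : realType) (n : nat) (c : 'cV[R]_n) (Q : 'M[R]_n) :
    set 'cV[R]_n :=
  [set c + psd_sqrtmx Q *m w | w in l2ball n 1].

(* Main.v *)
(** The support function of the Euclidean ball of radius [delta] in the direction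
    [g] is [delta * ||g||]: Cauchy-Schwarz bounds it, and [e = (delta / ||g||) g]
    attains it.  For the ellipsoid, the square root [S] of [Q] is symmetric, so
    the support function in the direction [g] is [||S g|| = sqrt (g Q g^T)]. *)

Require Import Defs.
From mathcomp Require Import all_boot all_order all_algebra.
From mathcomp Require Import boolp classical_sets reals.
From mathcomp Require Import ring lra.

Set Implicit Arguments.
Unset Strict Implicit.
Unset Printing Implicit Defensive.

Import Order.TTheory GRing.Theory Num.Theory.

Local Open Scope classical_set_scope.
Local Open Scope ring_scope.

Section EuclideanNorm.

Variables (R : realType) (n : nat).
Implicit Types (u v : 'cV[R]_n) (g : 'rV[R]_n).

Lemma sqr_l2norm v : l2norm v ^+ 2 = \sum_(i < n) v i 0 ^+ 2.
Proof. by rewrite sqr_sqrtr // sumr_ge0 // => i _; exact: sqr_ge0. Qed.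

Lemma l2norm_ge0 v : 0 <= l2norm v.
Proof. exact: sqrtr_ge0. Qed.

Lemma l2normZ a v : l2norm (a *: v) = `|a| * l2norm v.
Proof.
rewrite -sqrtr_sqr -sqrtrM ?sqr_ge0 // mulr_sumr.
by congr Num.sqrt; apply: eq_bigr => i _; rewrite !mxE exprMn.
Qed.

Lemma l2norm_delta (i : 'I_n) : l2norm (delta_mx i 0 : 'cV[R]_n) = 1.
Proof.
rewrite /l2norm (bigD1 i) //= big1 => [|j /negPf ji].
  by rewrite mxE !eqxx expr1n addr0 sqrtr1.
by rewrite mxE ji expr0n.
Qed.

(** A single square is at most the sum of all squares. This gives both the definiteness of the norm
    and the inclusion of the ball in the cube used for boxes. *)
Lemma ler_coord_l2norm v i : `|v i 0| <= l2norm v.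
Proof.
rewrite -sqrtr_sqr ler_wsqrtr // (bigD1 i) //= lerDl.
by rewrite sumr_ge0 // => j _; exact: sqr_ge0.
Qed.

Lemma l2norm_eq0 v : l2norm v = 0 -> v = 0.
Proof.
move=> v0; apply/colP => i; apply/eqP.
by rewrite mxE -normr_le0 -v0 ler_coord_l2norm.
Qed.

Lemma mulmx_tr_l2norm g : (g *m g^T) 0 0 = l2norm g^T ^+ 2.
Proof. by rewrite sqr_l2norm mxE; apply: eq_bigr => i _; rewrite !mxE expr2. Qed.

Lemma cauchy_schwarz g v : (g *m v) 0 0 <= l2norm g^T * l2norm v.
Proof.
set a := l2norm g^T; set b := l2norm v.
(* If either norm vanishes, so does the vector, and both sides are zero; otherwise division by
   [a * b] is allowed. *)
have [a0|a_neq0] := eqVneq a 0.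
  by rewrite -[g]trmxK (l2norm_eq0 a0) trmx0 mul0mx mxE a0 mul0r.
have [b0|b_neq0] := eqVneq b 0.
  by rewrite (l2norm_eq0 b0) mulmx0 mxE b0 mulr0.
have ab_gt0 : 0 < a * b.
  by rewrite mulr_gt0 // lt_neqAle eq_sym ?a_neq0 ?b_neq0 l2norm_ge0.
(* With [a] and [b] the two norms, this sum of squares expands to
   [2 * (a * b) * (a * b - g *m v)]. *)
have : 0 <= \sum_(i < n) (b * g 0 i - a * v i 0) ^+ 2.
  by rewrite sumr_ge0 // => i _; exact: sqr_ge0.
have -> : \sum_(i < n) (b * g 0 i - a * v i 0) ^+ 2 =
    b ^+ 2 * (\sum_(i < n) g^T i 0 ^+ 2) - 2 * (a * b) * (g *m v) 0 0
      + a ^+ 2 * \sum_(i < n) v i 0 ^+ 2.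
  rewrite mxE !mulr_sumr -sumrB -big_split /=.
  by apply: eq_bigr => i _; rewrite mxE; ring.
rewrite -!sqr_l2norm -/a -/b => ge0; rewrite -(ler_pM2l ab_gt0); lra.
Qed.

Lemma l2ball_support g v (r : R) :
  l2ball n r v -> (g *m v) 0 0 <= l2norm g^T * r.
Proof.
by move=> vr; apply: le_trans (cauchy_schwarz g v) _; rewrite ler_wpM2l ?l2norm_ge0.
Qed.

Lemma l2ball_support_attained g (r : R) : g != 0 -> 0 <= r ->
  exists2 v, l2ball n r v & (g *m v) 0 0 = l2norm g^T * r.
Proof.
move=> g0 r0; set a := l2norm g^T.
have a0 : a != 0.
  by apply: contraNneq g0 => /l2norm_eq0 gT0; rewrite -[g]trmxK gT0 trmx0.
exists ((r / a) *: g^T).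
  by rewrite /l2ball /= l2normZ ger0_norm ?divr_ge0 ?l2norm_ge0 // divfK.
by rewrite -scalemxAr mxE mulmx_tr_l2norm -/a; field.
Qed.

End EuclideanNorm.

Section PontryaginDifference.

Variables (R : realType) (n : nat).
Implicit Types (z c : 'cV[R]_n).

(** The rows decouple: each constraint holds for all shifts in the ball iff it holds at the worst
    shift for that row. The forward direction tests the maximizer, which exists since the row is
    nonzero; the converse uses the support bound. *)
Lemma polyhedron_diff_ball m (F : 'M[R]_(m, n)) (f : 'cV[R]_m) z (r : R) :
  (forall k, row k F != 0) -> 0 <= r ->
  pontryagin_diff (polyhedron F f) (l2ball n r) z <->
  forall k, (row k F *m z) 0 0 + l2norm (row k F)^T * r <= f k 0.
Proof.
have rowE k v : (F *m v) k 0 = (row k F *m v) 0 0 by rewrite -row_mul [RHS]mxE.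
move=> F0 r0; split=> [zF k|zF e er k].
  have [e er <-] := l2ball_support_attained (F0 k) r0.
  by have := zF e er k; rewrite rowE mulmxDr mxE.
apply: le_trans (zF k); rewrite rowE mulmxDr mxE lerD2l.
exact: l2ball_support.
Qed.

(** The ball touches each face of the cube of half-width [r] at a point [r] or [- r] times a basis
    vector, and lies inside that cube. The touching points give the forward direction, the inclusion
    the converse. *)
Lemma box_diff_ball (lo hi : 'cV[R]_n) z (r : R) : 0 <= r ->
  pontryagin_diff (box lo hi) (l2ball n r) z <->
  lecv (lo + const_mx r) z /\ lecv z (hi - const_mx r).
Proof.
move=> r0; split=> [zB|[loz zhi] e er].
  have ballD i s : `|s| = r -> l2ball n r (s *: delta_mx i 0).
    by move=> sr; rewrite /l2ball /= l2normZ l2norm_delta sr mulr1.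
  split=> i.
    have /zB[/(_ i) + _] : l2ball n r ((- r) *: delta_mx i 0).
      by apply: ballD; rewrite normrN ger0_norm.
    by rewrite !mxE !eqxx mulr1 lerBrDr.
  have /zB[_ /(_ i)] : l2ball n r (r *: delta_mx i 0).
    by apply: ballD; rewrite ger0_norm.
  by rewrite !mxE !eqxx mulr1 lerBrDr.
have eir i : - r <= e i 0 <= r.
  by rewrite -ler_norml (le_trans (ler_coord_l2norm e i)).
split=> i; have /andP[] := eir i.
  by have := loz i; rewrite !mxE; lra.
by have := zhi i; rewrite !mxE; lra.
Qed.

Lemma ellipsoid_support (g : 'rV[R]_n) c (Q : 'M[R]_n) z : ellipsoid c Q z ->
  (g *m z) 0 0 <= (g *m c) 0 0 + Num.sqrt ((g *m Q *m g^T) 0 0).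
Proof.
rewrite /ellipsoid /psd_sqrtmx => -[w w1 <-]; rewrite mulmxDr mxE lerD2l.
case: xgetP => [S _ [[Ssym _] SQ]|_]; last first.
  (* The junk value [S = 0]: the set is then the single point [c], so the
     existence of a square root of [Q] is not needed. *)
  by rewrite mul0mx mulmx0 mxE sqrtr_ge0.
(* The support bound on the unit ball is applied in the direction [g *m S]. *)
rewrite mulmxA (le_trans (l2ball_support _ w1)) // mulr1.
have -> : g *m Q *m g^T = (g *m S) *m (g *m S)^T.
  by rewrite -SQ trmx_mul Ssym !mulmxA.
by rewrite mulmx_tr_l2norm sqrtr_sqr ger0_norm ?l2norm_ge0.
Qed.

End PontryaginDifference.

Theorem lemma1 (R : realType) (m n : nat) (F : 'M[R]_(m, n)) (f : 'cV[R]_m)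
    (hX : polyhedron F f !=set0) (hF : forall k : 'I_m, row k F != 0) :
  [/\ forall (zhat : 'cV[R]_n) (delta : R), 0 <= delta ->
        (pontryagin_diff (polyhedron F f) (l2ball n delta) zhat <->
         forall k : 'I_m,
           (row k F *m zhat) 0 0 + l2norm (row k F)^T * delta <= f k 0),
      forall lo hi : 'cV[R]_n, polyhedron F f = box lo hi ->
        forall (zhat : 'cV[R]_n) (delta : R), 0 <= delta ->
        (pontryagin_diff (polyhedron F f) (l2ball n delta) zhat <->
         lecv (lo + const_mx delta) zhat /\ lecv zhat (hi - const_mx delta))
    & forall (c : 'cV[R]_n) (Q : 'M[R]_n) (deltabar : R), psdmx Q ->
        (forall k : 'I_m,
           (row k F *m c) 0 0 + Num.sqrt ((row k F *m Q *m (row k F)^T) 0 0)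
             + l2norm (row k F)^T * deltabar <= f k 0) ->
        forall (zhat : 'cV[R]_n) (delta : R), 0 <= delta ->
          ellipsoid c Q zhat -> delta <= deltabar ->
          pontryagin_diff (polyhedron F f) (l2ball n delta) zhat].
Proof.
split=> [zhat delta d0|lo hi -> zhat delta d0|c Q dbar _ cF zhat delta d0 zE dd].
- exact: polyhedron_diff_ball.
- exact: box_diff_ball.
(* Row by row, the ellipsoid's support function bounds the nominal term, and the ball term is
   monotone in the radius. *)
- apply/polyhedron_diff_ball => // k; apply: le_trans (cF k).
  by apply: lerD; [exact: ellipsoid_support | rewrite ler_wpM2l ?l2norm_ge0].
Qed.
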